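(* If $G$ is a wheel-free graph on at least two vertices that contains no subdivision of $K_{3,3}$ (as a subgraph), then $G$ has at least two vertices of degree at most $2$.
   Context: Graphs are finite, simple and undirected. A graph $G$ is wheel-free if it contains no wheel as a subgraph, i.e. there is no cycle $C$ of $G$ (as a subgraph, not necessarily induced) and vertex $v\in V(G)\setminus V(C)$ such that $v$ has at least three neighbors in $V(C)$. *)

(* Defs.v *)
From HB Require Import structures.
From mathcomp Require Import all_boot.

Set Implicit Arguments.
Unset Strict Implicit.
Unset Printing Implicit Defensive.

Record sgraph := SGraph {
  vertex :> finType;
  edge : rel vertex;
  edge_sym : symmetric edge;
  edge_irrefl : irreflexive edge }.

Arguments edge {s}.

Definition neighbors (G : sgraph) (v : G) : {set G} := [set u | edge v u].

Definition degree (G : sgraph) (v : G) : nat := #|neighbors v|.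

(* [ucycle] alone also accepts the empty sequence and, by symmetry of the edge
   relation, a single edge traversed back and forth. *)
Definition is_cycle (G : sgraph) (c : seq G) : Prop :=
  ucycle edge c /\ 3 <= size c.

Definition wheel_free (G : sgraph) : Prop :=
  ~ exists (c : seq G) (v : G),
      [/\ is_cycle c, v \notin c & 3 <= #|neighbors v :&: [set u in c]|].

(* [f] places the branch vertices, and [P x y] lists the inner vertices of the
   path from [f x] to [f y] replacing the edge xy, so that an unsubdivided edge
   has an empty list. An edge is seen as two ordered pairs, for which the paths
   are the reverse of each other. The values of [P] at non-edges are irrelevant.
   The branch vertices and the paths form the subgraph of [G] that is a
   subdivision of [H]. *)
Definition contains_subdivision (H G : sgraph) : Prop :=
  exists (f : H -> G) (P : H -> H -> seq G),
    [/\ injective f,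
        forall x y, edge x y ->
          path edge (f x) (rcons (P x y) (f y)) /\
          uniq (f x :: rcons (P x y) (f y)),
        forall x y, edge x y -> P y x = rev (P x y),
        forall x y z, edge x y -> f z \notin P x y
      & forall x y x' y' u, edge x y -> edge x' y' ->
          u \in P x y -> u \in P x' y' ->
          (x', y') = (x, y) \/ (x', y') = (y, x)].

Definition bipartite_rel (A B : Type) : rel (A + B) := fun u v =>
  match u, v with
  | inl _, inr _ | inr _, inl _ => true
  | _, _ => false
  end.

Lemma bipartite_rel_sym (A B : Type) : symmetric (@bipartite_rel A B).
Proof. by case=> ? []. Qed.

Lemma bipartite_rel_irrefl (A B : Type) : irreflexive (@bipartite_rel A B).
Proof. by case. Qed.

Definition complete_bipartite (m n : nat) : sgraph :=
  @SGraph ('I_m + 'I_n)%type (@bipartite_rel 'I_m 'I_n)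
    (@bipartite_rel_sym _ _) (@bipartite_rel_irrefl _ _).

(* Main.v *)
(* Suppose that at most one vertex has degree at most 2.

   A vertex v cannot have three neighbours x, y, z in a biconnected subgraph B
   avoiding v. Indeed, take a cycle C of B through x and y and a fan from z to two
   vertices p, q of C. The resulting theta graph contains either a cycle through x,
   y and z, giving a wheel centred at v, or three p-q paths through x, y, z
   respectively, giving a subdivision of K_{3,3} with sides {p, q, v} and {x, y, z}.

   Such v and B exist. Let S be a minimal set of at least two vertices whose induced
   degrees are at least 3 except at one vertex e; then deleting a vertex of S leaves
   it connected. Choose v in S, v <> e, and a biconnected B containing e in S - v with
   B of maximum size. If S = B + v, the neighbours of v are in B. Otherwise let K be
   a component of S - v - B: by maximality K is attached to B at a single vertex c,
   and every vertex of K separates c from v in K + c + v, so that K is an induced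
   path and contains a vertex of degree 2 of S, a contradiction. *)
Require Import Defs.
From HB Require Import structures.
From mathcomp Require Import all_boot.

Set Implicit Arguments.
Unset Strict Implicit.
Unset Printing Implicit Defensive.

(** * Theta graphs, subdivisions of $K_{3,3}$ and wheels *)

Lemma perm_cons_rev_cat (T : eqType) (x : T) s l : perm_eq (x :: s ++ rev l) (s ++ x :: l).
Proof. by rewrite -(cat1s x) perm_catCA perm_cat2l perm_cons perm_rev. Qed.

Lemma path_rev (G : sgraph) (x y : G) p :
  path edge x (rcons p y) = path edge y (rcons (rev p) x).
Proof.
have := rev_path edge y (rcons (rev p) x).
rewrite last_rcons belast_rcons rev_cons revK => ->.
by apply: eq_path => u w; rewrite edge_sym.
Qed.

(** The sides of the subdivision are [p], [q], [v] and the three vertices [m j]. The lists [L j] and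
    [R j] subdivide the edges from [p] and [q] to [m j]; the edges from [v] stay unsubdivided, hence
    the empty last row of [Q]. *)
Lemma K33_subdivision_theta (G : sgraph) (p q v : G) (m : 'I_3 -> G)
    (L R : 'I_3 -> seq G) :
  (forall j, path edge p (rcons (L j) (m j))) ->
  (forall j, path edge q (rcons (R j) (m j))) ->
  (forall j, edge v (m j)) ->
  uniq [:: p; q; v] ->
  (forall j, uniq (m j :: L j ++ R j)) ->
  (forall j u, u \in m j :: L j ++ R j -> u \notin [:: p; q; v]) ->
  (forall j j' u, u \in m j :: L j ++ R j -> u \in m j' :: L j' ++ R j' ->
     j = j') ->
  contains_subdivision (complete_bipartite 3 3) G.
Proof.
move=> pL pR vm Upqv Um Tout Tdisj.
pose br (i : 'I_3) := nth p [:: p; q; v] i.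
pose Q (i j : 'I_3) := nth [::] [:: L j; R j; [::]] i.
have brP i : br i \in [:: p; q; v] by rewrite mem_nth.
have br_inj : injective br.
  by move=> i j /eqP; rewrite nth_uniq // => /eqP/val_inj.
have QT i j u : u \in Q i j -> u \in m j :: L j ++ R j.
  by case: i => [[|[|[|//]]]] i; rewrite /Q //= inE mem_cat => ->; rewrite ?orbT.
have Qm i j : m j \notin Q i j.
  apply/negP; move: (Um j); rewrite /= mem_cat.
  by case: i => [[|[|[|//]]]] i; rewrite /Q //= => /andP[/norP[/negP ? /negP ?] _].
have Qout i j u : u \in Q i j -> u \notin [:: p; q; v] by move=> /QT/Tout.
have Qpath i j : path edge (br i) (rcons (Q i j) (m j)).
  by case: i => [[|[|[|//]]]] i; rewrite /br /Q /= ?vm.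
have Quniq i j : uniq (br i :: rcons (Q i j) (m j)).
  rewrite cons_uniq rcons_uniq mem_rcons inE Qm negb_or /=.
  have -> : br i != m j.
    by apply: contraTneq (brP i) => ->; apply: (Tout j); rewrite mem_head.
  have -> : br i \notin Q i j.
    by apply: contraTN (brP i) => /Qout.
  move: (Um j); rewrite /= cat_uniq => /and4P[_ ? _ ?].
  by case: i => [[|[|[|//]]]] i.
have Qdisj i j i' j' u : u \in Q i j -> u \in Q i' j' -> i = i' /\ j = j'.
  move=> uQ uQ'; have Ej := Tdisj _ _ _ (QT _ _ _ uQ) (QT _ _ _ uQ'); subst j'.
  split=> //; apply: val_inj; move: (Um j) uQ uQ'; rewrite /Q /= cat_uniq.
  case/and4P=> _ _ /hasPn LR _.
  case: i => [[|[|[|//]]]] i; case: i' => [[|[|[|//]]]] i' //= uL uR.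
    by move: (LR u uR); rewrite /= uL.
  by move: (LR u uL); rewrite /= uR.
pose f (s : 'I_3 + 'I_3) := match s with inl i => br i | inr j => m j end.
pose P (s t : 'I_3 + 'I_3) := match s, t with
  | inl i, inr j => Q i j | inr j, inl i => rev (Q i j) | _, _ => [::] end.
have m_inj j j' : m j = m j' -> j = j'.
  by move=> E; apply: (Tdisj j j' (m j)); rewrite ?E mem_head.
have brm i j : br i <> m j.
  by move=> E; move: (Tout j (m j)); rewrite mem_head -E brP => /(_ isT).
exists f, P; split.
- move=> [i|j] [i'|j'] //= E; first by rewrite (br_inj _ _ E).
  + by case: (brm _ _ E).
  + by case: (brm _ _ (esym E)).
  + by rewrite (m_inj _ _ E).
- move=> [i|j] [i'|j'] //= _; first by split; [exact: Qpath | exact: Quniq].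
  rewrite -path_rev; split; first exact: Qpath.
  rewrite -[_ && _]/(uniq (m j :: rcons (rev (Q i' j)) (br i'))).
  by rewrite -rev_uniq rev_cons rev_rcons revK; exact: Quniq.
- by move=> [i|j] [i'|j'] //= _; rewrite revK.
- have H i j (z : 'I_3 + 'I_3) : f z \notin Q i j.
    apply/negP; case: z => [i'|j'] /= H.
      by move: (Qout _ _ _ H); rewrite brP.
    have E : j' = j by apply: Tdisj (QT _ _ _ H); rewrite mem_head.
    by move: H; rewrite E => H; move: (Qm i j); rewrite H.
  by move=> [i|j] [i'|j'] //= z _; rewrite ?mem_rev; exact: H.
- move=> [i|j] [i'|j'] // [k|l] [k'|l'] // u _ _ /=; rewrite ?mem_rev => H1 H2;
    have [-> ->] := Qdisj _ _ _ _ _ H1 H2; by [left | right].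
Qed.

Section WheelFree.
Variable G : sgraph.
Implicit Types (u v w x y z p q a b c e : G) (S T B D X H : {set G}) (s l r : seq G).

Lemma wheel_free_cycle s v x y z :
  wheel_free G -> ucycle edge s -> v \notin s ->
  edge v x -> edge v y -> edge v z -> uniq [:: x; y; z] ->
  x \in s -> y \in s -> z \notin s.
Proof.
move=> wf cyc_s vs vx vy vz Uxyz xs ys; apply/negP=> zs; case: wf; exists s, v.
split=> //.
  (* Three distinct vertices on [s] also give the length bound of [is_cycle]. *)
  split=> //; have Us : {subset [:: x; y; z] <= s}.
    by apply/allP; rewrite /= xs ys zs.
  exact: (uniq_leq_size Uxyz Us).
apply/card_gt2P; exists x, y, z; rewrite !inE vx vy vz xs ys zs; split=> //.
move: Uxyz; rewrite /= !inE negb_or => /and3P[/andP[-> xz] -> _].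
by rewrite eq_sym.
Qed.

(** If both lists are empty, the result is the edge [pq] traversed back and forth, which [ucycle]
    accepts; the length bound is recovered in [wheel_free_cycle]. *)
Lemma ucycle_two_paths p q s l :
  path edge p (rcons s q) -> path edge p (rcons l q) ->
  uniq (p :: q :: s ++ l) -> ucycle edge (p :: s ++ q :: rev l).
Proof.
move=> pS pL U; apply/andP; split.
  by rewrite /= rcons_cat /= -cat_rcons cat_path last_rcons pS -path_rev.
rewrite -(perm_uniq (s1 := p :: q :: s ++ l)) // perm_cons.
by rewrite -{1}[l]revK perm_cons_rev_cat.
Qed.

(** Each path is cut at its neighbour of [v]. The second half is reversed, since both halves have to
    be read towards that neighbour. *)
Lemma K33_subdivision_paths p q v x y z s l r :
  path edge p (rcons s q) -> path edge p (rcons l q) ->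
  path edge p (rcons r q) -> uniq ([:: p; q; v] ++ s ++ l ++ r) ->
  edge v x -> edge v y -> edge v z -> x \in s -> y \in l -> z \in r ->
  contains_subdivision (complete_bipartite 3 3) G.
Proof.
move=> pS pL pR U vx vy vz xs yl zr.
case/splitPr: xs pS U => s1 s2; case/splitPr: yl pL => l1 l2.
case/splitPr: zr pR => r1 r2 pR pL pS U.
pose m (j : 'I_3) := nth x [:: x; y; z] j.
pose F (j : 'I_3) := nth [::] [:: s1; l1; r1] j.
pose H (j : 'I_3) := nth [::] [:: rev s2; rev l2; rev r2] j.
pose Z (j : 'I_3) := nth [::] [:: s1 ++ x :: s2; l1 ++ y :: l2; r1 ++ z :: r2] j.
have permZ j : perm_eq (m j :: F j ++ H j) (Z j).
  by case: j => [[|[|[|//]]]] j; rewrite /m /F /H /Z /= perm_cons_rev_cat.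
have [Ua [Uo Ub]] : uniq [:: p; q; v] /\ (forall j u, u \in Z j -> u \notin [:: p; q; v])
    /\ uniq ((s1 ++ x :: s2) ++ (l1 ++ y :: l2) ++ r1 ++ z :: r2).
  move: U; rewrite (cat_uniq [:: p; q; v]) => /and3P[-> /hasPn out ->].
  split=> //; split=> // j u uZ.
  apply: out; rewrite !(mem_cat u (_ ++ _)).
  by case: j uZ => [[|[|[|//]]]] j /= ->; rewrite ?orbT.
have split_path t t1 t2 : path edge p (rcons (t1 ++ t :: t2) q) ->
    path edge p (rcons t1 t) /\ path edge q (rcons (rev t2) t).
  by rewrite rcons_cat /= -cat_rcons cat_path last_rcons -path_rev => /andP[].
apply: (@K33_subdivision_theta G p q v m F H) => //.
- by case=> [[|[|[|//]]]] j; rewrite /F /m /=; [case/split_path: pS|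
    case/split_path: pL|case/split_path: pR].
- by case=> [[|[|[|//]]]] j; rewrite /H /m /=; [case/split_path: pS|
    case/split_path: pL|case/split_path: pR].
- by case=> [[|[|[|//]]]] j.
- move=> j; rewrite (perm_uniq (permZ j)); move: Ub.
  rewrite cat_uniq [in X in [&& _, _ & X]]cat_uniq => /and5P[? _ ? _ ?].
  by case: j => [[|[|[|//]]]] j.
- by move=> j u; rewrite (perm_mem (permZ j)) => /Uo.
move=> j k u; rewrite !(perm_mem (permZ _)) => uj uk; apply: val_inj.
move: Ub; rewrite cat_uniq [in X in [&& _, _ & X]]cat_uniq.
case/and5P=> _ /hasPn/(_ u) out1 _ /hasPn/(_ u) out2 _.
move: out1 out2; rewrite /= mem_cat => out1 out2.
case: j uj => [[|[|[|//]]]] j uj; case: k uk => [[|[|[|//]]]] k uk //=; move: uj uk;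
  rewrite /Z /= => uj uk; move: out1 out2; rewrite ?uj ?uk ?orbT => out1 out2;
  by [have := out1 isT | have := out2 isT].
Qed.

(** If [x] and [y] lie on the same one of the paths [s] and [l], ends included, that path and [r]
    form a cycle through [x], [y], [z], hence a wheel. Otherwise they are inner vertices of
    different paths, and the three paths with [v] give $K_{3,3}$. *)
Lemma theta_excluded p q v x y z s l r :
  wheel_free G -> ~ contains_subdivision (complete_bipartite 3 3) G ->
  path edge p (rcons s q) -> path edge p (rcons l q) ->
  path edge p (rcons r q) -> uniq ([:: p; q; v] ++ s ++ l ++ r) ->
  edge v x -> edge v y -> edge v z -> uniq [:: x; y; z] ->
  x \in [:: p, q & s ++ l] -> y \in [:: p, q & s ++ l] -> z \notin r.
Proof.
move=> wf nK pS pL pR U vx vy vz Uxyz xC yC; apply/negP=> zr.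
(* The pair is left arbitrary because [x] and [y] can be distributed over [s] and [l] in either
   order. *)
have K x' y' : x' \in s -> y' \in l -> edge v x' -> edge v y' -> False.
  move=> xs yl vx' vy'; apply: nK.
  exact: (K33_subdivision_paths pS pL pR U vx' vy' vz xs yl zr).
(* Here [t] stands for [s] or [l], and [r] closes it to a cycle. *)
have W t : path edge p (rcons t q) -> {subset t <= s ++ l} -> uniq (t ++ r) ->
    x \in [:: p, q & t] -> y \in [:: p, q & t] -> False.
  move=> pT sT UT xT yT.
  move: U; rewrite (cat_uniq [:: p; q; v]) => /and3P[Upqv /hasPn out _].
  have out' w : w \in t ++ r -> w \notin [:: p; q; v].
    by rewrite mem_cat => H; apply: out; rewrite catA mem_cat; case/orP: H => [/sT|] ->;
      rewrite ?orbT.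
  have Ut : uniq (p :: q :: t ++ r).
    rewrite -[_ :: _]/([:: p; q] ++ (t ++ r)) cat_uniq UT andbT; apply/andP; split.
      by move: Upqv; rewrite /= !inE !negb_or; case/and3P=> /andP[->].
    apply/hasPn => w /out'; rewrite /= !inE !negb_or.
    by case/and3P=> /negPf-> /negPf->.
  have cyc := ucycle_two_paths pT pR Ut.
  have E : p :: t ++ q :: rev r =i [:: p, q & t ++ r].
    by move=> w; rewrite !(inE, mem_cat, mem_rev); case: (w == p); case: (w == q);
      rewrite /= ?orbT.
  suff: z \notin p :: t ++ q :: rev r by rewrite E !inE mem_cat zr !orbT.
  apply: (wheel_free_cycle wf cyc _ vx vy vz Uxyz); rewrite E.
  - have vpq : v \notin [:: p; q] by move: Upqv; rewrite /= !inE => /and3P[];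
      rewrite !negb_or ![v == _]eq_sym => /andP[_ ->] ->.
    rewrite -[_ :: _]/([:: p; q] ++ (t ++ r)) mem_cat negb_or vpq /=.
    by apply/negP => /out'; rewrite !inE eqxx !orbT.
  - by move: xT; rewrite !inE mem_cat; case/or3P=> ->; rewrite ?orbT.
  - by move: yT; rewrite !inE mem_cat; case/or3P=> ->; rewrite ?orbT.
have Usr : uniq (s ++ r) /\ uniq (l ++ r).
  move: U; rewrite (cat_uniq [:: p; q; v]) => /and3P[_ _].
  rewrite !cat_uniq has_cat negb_or => /and5P[-> /andP[_ ->] ? ? ?].
  by split=> //=; apply/and3P.
case: Usr => Us Ul.
have [sA sB] : {subset s <= s ++ l} /\ {subset l <= s ++ l}.
  by split=> w; rewrite mem_cat => ->; rewrite ?orbT.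
have Ws : ~~ ((x \in [:: p, q & s]) && (y \in [:: p, q & s])).
  by apply/negP=> /andP[]; apply: W.
have Wl : ~~ ((x \in [:: p, q & l]) && (y \in [:: p, q & l])).
  by apply/negP=> /andP[]; apply: W.
have Kxy : ~~ ((x \in s) && (y \in l)) by apply/negP=> /andP[/K K' /K' []].
have Kyx : ~~ ((y \in s) && (x \in l)) by apply/negP=> /andP[/K K' /K' []].
(* Each of [x], [y] is [p], [q] or an inner vertex of [s] or [l]; the four exclusions refute every
   combination. *)
move: xC yC Ws Wl Kxy Kyx; rewrite !inE !mem_cat.
by case: (x == p); case: (x == q); case: (x \in s); case: (x \in l);
  case: (y == p); case: (y == q); case: (y \in s); case: (y \in l).
Qed.

(** * Connectivity of induced subgraphs *)

(** An induced subgraph is a relation on all of [G], so that sets can vary over a fixed vertex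
    type. *)
Definition induced_edge S : rel G := [rel x y | [&& x \in S, y \in S & edge x y]].

Lemma induced_edgeP S x y :
  reflect [/\ x \in S, y \in S & edge x y] (induced_edge S x y).
Proof. exact: and3P. Qed.

Definition connected S := [forall x in S, forall y in S, connect (induced_edge S) x y].

(** As [x] may lie outside [S], a set that misses some vertex of [G] is itself connected. The ends
    of a single edge form a biconnected set. *)
Definition biconnected S := [forall x, connected (S :\ x)].

Lemma connectedP S :
  reflect {in S &, forall x y, connect (induced_edge S) x y} (connected S).
Proof.
apply: (iffP forall_inP) => [conS x y xS yS|conS x xS].
  exact: (forall_inP (conS x xS)).
by apply/forall_inP => y; apply: conS.
Qed.

Lemma connect_induced_sym S : connect_sym (induced_edge S).
Proof. by apply: sym_connect_sym => x y; rewrite /induced_edge /= edge_sym andbCA. Qed.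

Lemma connect_induced1 S x y :
  x \in S -> y \in S -> edge x y -> connect (induced_edge S) x y.
Proof. by move=> xS yS xy; apply/connect1/induced_edgeP. Qed.

Lemma connect_inducedS S T x y :
  S \subset T -> connect (induced_edge S) x y -> connect (induced_edge T) x y.
Proof.
move=> /subsetP sST; apply: connect_sub => u w /induced_edgeP[/sST uT /sST wT uw].
exact: connect_induced1.
Qed.

Lemma path_induced S x s :
  path (induced_edge S) x s -> path edge x s /\ {subset s <= S}.
Proof.
elim: s x => //= y s IHs x /andP[/induced_edgeP[_ yS xy]] /IHs[-> sS].
by rewrite xy; split=> // u; rewrite inE => /predU1P[->|/sS].
Qed.

Lemma connect_on_path S x y s :
  path edge x s -> {subset x :: s <= S} -> y \in x :: s -> connect (induced_edge S) x y.
Proof.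
move=> xs sS; apply: path_connect; elim: s x xs sS => //= z s IHs x /andP[xz zs] sS.
rewrite IHs // ?andbT => [|u us]; last by apply: sS; rewrite inE us orbT.
by apply/induced_edgeP; rewrite !sS ?inE ?eqxx ?orbT.
Qed.

Lemma connect_closed S D x y :
  (forall u w, u \in D -> w \in S -> edge u w -> w \in D) ->
  x \in D -> connect (induced_edge S) x y -> y \in D.
Proof.
move=> clD xD /connectP[s xs ->]; elim: s x xD xs => //= z s IHs x xD.
by case/andP=> /induced_edgeP[_ zS xz]; apply: IHs; apply: clD xz.
Qed.

Lemma connected_extend S T :
  connected S -> S \subset T ->
  {in T, forall y, exists2 x, x \in S & connect (induced_edge T) y x} -> connected T.
Proof.
move=> /connectedP conS sST attach; apply/connectedP=> x y xT yT.
have [x' x'S xx'] := attach x xT; have [y' y'S yy'] := attach y yT.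
apply: (connect_trans xx'); rewrite connect_induced_sym; apply: (connect_trans yy').
by apply: connect_inducedS (conS _ _ _ _).
Qed.

Lemma biconnected_connected S x : biconnected S -> x \notin S -> connected S.
Proof.
move=> /forallP/(_ x) conS xS; suff <- : S :\ x = S by [].
by apply/setDidPl; rewrite disjoint_sym disjoints1.
Qed.

(** * Ears and fans in biconnected sets *)

(** A simple path in [D] makes an ear from [a] to [b]. After the deletion of a vertex, the rest of
    [B] is still connected, and every remaining vertex of the ear reaches [a] or [b] along it. *)
Lemma biconnected_ear B D a b x y :
  biconnected B -> [disjoint B & D] -> a \in B -> b \in B -> a != b ->
  x \in D -> connect (induced_edge D) x y -> edge a x -> edge b y ->
  exists X, [/\ B \proper X, X \subset B :|: D & biconnected X].
Proof.
move=> biB disjBD aB bB ab xD /connectP[s0 xs0 Ey] ax yb; subst y.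
have {xs0 yb}[s [xs Us sD yb]] : exists s, [/\ path edge x s, uniq (x :: s),
    {subset x :: s <= D} & edge b (last x s)].
  case/shortenP: xs0 yb => s xs Us _ yb; exists s.
  have [-> sD] := path_induced xs; split=> // u.
  by rewrite inE => /predU1P[->|/sD].
have DnB u : u \in D -> u \notin B.
  by move=> uD; apply: contraL uD => /(disjointFr disjBD)->.
have snB u : u \in x :: s -> u \notin B by move/sD/DnB.
exists (B :|: [set u in x :: s]); split.
- rewrite properE subsetUl; apply/subsetPn; exists x; rewrite ?inE ?eqxx ?orbT //.
  exact: snB (mem_head _ _).
- by apply/setUS/subsetP => u; rewrite inE => /sD.
apply/forallP=> z; set X := _ :\ z.
have sBX : B :\ z \subset X by apply/setSD/subsetUl.
apply: (connected_extend (forallP biB z) sBX) => u.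
have inX w : w != z -> (w \in B) || (w \in x :: s) -> w \in X.
  by rewrite /X in_setD1 in_setU inE => ->.
rewrite {1}/X => /setD1P[uz /setUP[uB|]].
  by exists u => //; rewrite !inE uz.
rewrite inE => us'.
have [s1 [s2 Es]] : exists s1 s2, x :: s = s1 ++ u :: s2.
  by case/splitPr: us' => s1 s2; exists s1, s2.
have zu : z != u by rewrite eq_sym.
(* The vertex [u] escapes forward to [b] if the deleted [z] precedes it on the ear, and back to [a]
   otherwise. *)
case zs1: ((z == a) || (z \in s1)).
- have zb : b != z.
    case/orP: zs1 => [/eqP->|zs1]; first by rewrite eq_sym.
    by apply: contraTneq bB => ->; apply: snB; rewrite Es mem_cat zs1.
  have zs2 : z \notin u :: s2.
    case/orP: zs1 => [/eqP->|zs1].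
      by apply: contraL aB => aus2; apply: snB; rewrite Es mem_cat aus2 orbT.
    move: Us; rewrite Es cat_uniq => /and3P[_ /hasPn H _].
    by apply/negP => /H /=; rewrite zs1.
  exists b; first by rewrite !inE zb.
  have Elast : last x s = last u s2 by rewrite -(last_cons x x s) Es last_cat.
  have us2 : path edge u s2.
    have : path edge a (x :: s) by rewrite /= ax.
    by rewrite Es cat_path /= => /and3P[].
  have s2X : {subset u :: s2 <= X}.
    move=> w ws2; apply: inX; first by apply: contraNneq zs2 => <-.
    by rewrite Es !mem_cat ws2 !orbT.
  apply: (connect_trans (connect_on_path us2 s2X (mem_last _ _))).
  apply: connect_induced1; first exact: s2X (mem_last _ _).
    by apply: inX; rewrite ?bB.
  by rewrite edge_sym -Elast.
move/negbT: zs1; rewrite negb_or => /andP[za zs1].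
have aX : a \in X by apply: inX; rewrite 1?eq_sym ?aB.
exists a; first by rewrite !inE eq_sym za.
rewrite connect_induced_sym.
have as1 : path edge a (rcons s1 u).
  have : path edge a (x :: s) by rewrite /= ax.
  by rewrite Es -cat_rcons cat_path => /andP[].
apply: (connect_on_path as1); last by rewrite inE mem_rcons mem_head orbT.
move=> w; rewrite inE => /predU1P[->//|ws].
apply: inX; last by rewrite Es -cat_rcons !mem_cat ws orbT.
by apply: contraTneq ws => ->; rewrite mem_rcons inE negb_or zu.
Qed.

(** A simple path is cut at its first vertex in [X]. *)
Lemma connect_first_hit S X x y :
  connect (induced_edge S) x y -> x \notin X -> y \in X ->
  exists s z, [/\ path edge x (rcons s z), uniq (x :: rcons s z),
    {subset rcons s z <= S}, z \in X & {in x :: s, forall u, u \notin X}].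
Proof.
case/connectP=> s0 /shortenP[s xs Us _] -> xX yX.
have [xs' sS] := path_induced xs.
have hX : has (mem X) s.
  by apply/hasP; exists (last x s) => //; move: (mem_last x s) yX; rewrite inE =>
    /predU1P[->|//]; rewrite (negPf xX).
case: {-1}_ _ _ / (split_find hX) (erefl s) => z s1 s2 zX /hasPn s1X Es.
exists s1, z; rewrite Es in xs' sS Us; split=> //.
- by move: xs'; rewrite cat_path => /andP[].
- by move: Us; rewrite -cat_cons cat_uniq => /andP[].
- by move=> u us; apply: sS; rewrite mem_cat us.
- by move=> u; rewrite inE => /predU1P[->|/s1X].
Qed.

(** Two paths from [y] that meet only in [y]. The lists omit [y] and include the far end, so an
    empty list means that [y] is already [a] or [b]. *)
Definition fan H a b y := exists l r,
  [/\ path edge y l /\ last y l = a, path edge y r /\ last y r = b,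
      uniq (y :: l ++ r) & {subset y :: l ++ r <= H}].

Lemma fan_sym H a b y : fan H a b y -> fan H b a y.
Proof.
move=> [l [r [l_a r_b U sH]]]; have E : perm_eq (y :: r ++ l) (y :: l ++ r).
  by rewrite perm_cons perm_catC.
by exists r, l; split; rewrite ?(perm_uniq E) // => u; rewrite (perm_mem E); apply: sH.
Qed.

(** A fan can be moved along an edge: [x] reaches one end by a path that avoids [y] and joins a
    branch, and the other end through [y] and the other branch. *)
Lemma fan_edge H a b y x :
  biconnected H -> a != b -> fan H a b y -> edge y x -> x \in H -> fan H a b x.
Proof.
move=> biH ab [l [r [l_a r_b U sH]]] yx xH.
pose joins l r := x \in l \/ exists s z,
  [/\ path edge x (rcons s z), uniq (x :: rcons s z), {subset rcons s z <= H :\ y},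
      z \in l & {in x :: s, forall u, u \notin l ++ r}].
(* Exchanging the branches, the one that contains [x], or that a path from [x] avoiding [y] meets
   first, may be taken to be [l]. *)
wlog: a b l r ab l_a r_b U sH / joins l r.
- move=> W; have Wl := W a b l r ab l_a r_b U sH.
  have Wr : joins r l -> fan H a b x.
    move=> H'; apply: fan_sym; have E : perm_eq (y :: r ++ l) (y :: l ++ r).
      by rewrite perm_cons perm_catC.
    apply: (W b a r l _ r_b l_a _ _ H'); rewrite 1?eq_sym ?(perm_uniq E) // => u.
    by rewrite (perm_mem E); apply: sH.
  have [xl|xl] := boolP (x \in l); first by apply: Wl; left.
  have [xr|xr] := boolP (x \in r); first by apply: Wr; left.
  have xlr : x \notin l ++ r by rewrite mem_cat negb_or xl.
  have y_lr : y \notin l ++ r by case/andP: U.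
  (* Since [a] and [b] differ, the branches are not both empty and offer a target other than [y]. *)
  have [t t_lr] : exists t, t \in l ++ r.
    case: l l_a {W Wl Wr U sH xl xlr y_lr} => [|t l] l_a; last by exists t; rewrite mem_head.
    case: r r_b {xr} => [|t r] r_b; last by exists t; rewrite mem_head.
    by move: ab; rewrite -(proj2 l_a) -(proj2 r_b) eqxx.
  have yt : t != y by apply: contraNneq y_lr => <-.
  have xy : x != y by apply: contraTneq yx => ->; rewrite edge_irrefl.
  have con : connect (induced_edge (H :\ y)) x t.
    apply: (connectedP _ (forallP biH y)); rewrite in_setD1 ?xy ?yt //.
    by apply: sH; rewrite inE t_lr orbT.
  have [||s [z [ps Us sS zlr out]]] := @connect_first_hit _ [set u in l ++ r] _ _ con.
  + by rewrite inE.
  + by rewrite inE.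
  have {}out : {in x :: s, forall u, u \notin l ++ r} by move=> u /out; rewrite inE.
  move: zlr; rewrite inE mem_cat => /orP[zl|zr].
    by apply: Wl; right; exists s, z.
  apply: Wr; right; exists s, z; split=> // u /out; by rewrite !mem_cat orbC.
case: l_a r_b => pl la [pr rb] [xl|[s [z [ps Us sS zl out]]]].
(* With [x] on [l], one branch continues to [a] and the other goes back along [l] to [y] and then
   along [r]. *)
- case/splitPr: xl pl la U sH => l1 l2 pl la U sH.
  exists l2, (rcons (rev l1) y ++ r).
  have E : perm_eq (x :: l2 ++ rcons (rev l1) y ++ r) (y :: (l1 ++ x :: l2) ++ r).
    by clear; apply/permP => P; rewrite /= !count_cat -cats1 count_cat count_rev /=;
      do ?nat_norm; do ?nat_congr.
  rewrite -cat_rcons cat_path last_cat last_rcons path_rev in pl la.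
  case/andP: pl => pl1 pl2.
  split; rewrite ?(perm_uniq E) //; last by move=> u; rewrite (perm_mem E); apply: sH.
  by rewrite cat_path last_rcons last_cat last_rcons pl1.
case/splitPr: zl pl la U sH out => l1 l2 pl la U sH out.
(* One branch enters [l] at [z] and drops its beginning [l1]; the other uses the edge [xy] followed
   by [r]. *)
exists (rcons s z ++ l2), (y :: r).
rewrite -cat_rcons cat_path last_cat last_rcons in pl la.
case/andP: pl => _ pl2.
have sub u : u \in z :: l2 ++ y :: r -> u \in y :: (l1 ++ z :: l2) ++ r.
  by rewrite !(inE, mem_cat) => /or4P[] ->; rewrite ?orbT.
have subH u : u \in x :: rcons s z -> u \in H.
  by rewrite inE => /predU1P[->//|/sS/setD1P[]].
split.
- by rewrite cat_path last_rcons last_cat last_rcons ps.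
- by rewrite /= edge_sym yx.
- rewrite cat_rcons -catA -cat_cons cat_uniq; apply/and3P; split.
  + by move: Us; rewrite -rcons_cons rcons_uniq => /andP[].
  + apply/hasPn => u Hu; apply/negP => us; have := sub u Hu; rewrite inE.
    rewrite (negPf (out u us)) orbF => /eqP uy.
    move: us; rewrite uy inE => /predU1P[yx'|ys].
      by move: yx; rewrite yx' edge_irrefl.
    by have := sS y; rewrite mem_rcons inE ys orbT !inE eqxx => /(_ isT).
  + have E : perm_eq (l1 ++ z :: l2 ++ y :: r) (y :: (l1 ++ z :: l2) ++ r).
      by clear; apply/permP => P; rewrite /= !count_cat /= !count_cat /=;
      do ?nat_norm; do ?nat_congr.
    by move: U; rewrite -(perm_uniq E) cat_uniq => /and3P[].
move=> u; rewrite -catA -[_ :: _]/((x :: rcons s z) ++ _) mem_cat => /orP[/subH //|Hu].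
by apply/sH/sub; rewrite inE Hu orbT.
Qed.

(** At [a] a fan consists of an empty branch and a path to [b]; it is then moved edge by edge along
    a path from [a] to [y]. *)
Lemma biconnected_fan H a b y :
  biconnected H -> connected H -> a \in H -> b \in H -> y \in H -> a != b -> fan H a b y.
Proof.
move=> biH /connectedP conH aH bH yH ab.
have fan_a : fan H a b a.
  have /connectP[s0 /shortenP[s sp Us _] Eb] := conH a b aH bH.
  have [ps sH] := path_induced sp.
  by exists [::], s; split=> // u; rewrite inE => /predU1P[->|/sH].
have /connectP[s sp ->] := conH a y aH yH.
elim/last_ind: s sp => //= s x IHs; rewrite last_rcons rcons_path.
by case/andP=> /IHs fan_s /induced_edgeP[_ xH sx]; apply: fan_edge fan_s sx xH.
Qed.

(** * Neighbours of a vertex in a biconnected set avoiding it *)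

Lemma biconnected_excluded H v x y z :
  wheel_free G -> ~ contains_subdivision (complete_bipartite 3 3) G ->
  biconnected H -> v \notin H -> edge v x -> edge v y -> edge v z ->
  uniq [:: x; y; z] -> x \in H -> y \in H -> z \notin H.
Proof.
move=> wf nK biH vH vx vy vz Uxyz xH yH; apply/negP=> zH.
have conH := biconnected_connected biH vH.
have [xy xz yz] : [/\ x != y, x != z & y != z].
  by move: Uxyz; rewrite /= !inE negb_or => /and3P[/andP[-> ->] ->].
have [s [cyc_s xs ys sH]] : exists s, [/\ ucycle edge s, x \in s, y \in s & {subset s <= H}].
  have [u uH xu] : exists2 u, u \in H & edge x u.
    have /connectP[[|u s] /=] := connectedP _ conH x y xH yH.
      by move=> _ E; rewrite E eqxx in xy.
    by case/andP=> /induced_edgeP[_ uH xu] _ _; exists u.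
  have ux : u != x by apply: contraTneq xu => ->; rewrite edge_irrefl.
  (* The cycle consists of the edge [xu] and a fan from [t] to [u] and [x]. It passes through [y] as
     [t], or as [u] if [u] is [y]; then [z] serves as a start different from [u]. *)
  pose t := if u == y then z else y.
  have [tH tu tx] : [/\ t \in H, t != u & t != x].
    rewrite /t; case: (eqVneq u y) => [->|uy]; first by rewrite zH ![z == _]eq_sym yz xz.
    by rewrite yH [y == u]eq_sym uy eq_sym xy.
  have [l [r [[pl lu] [pr rx] U sH]]] := biconnected_fan biH conH uH xH tH ux.
  case: l / (lastP l) pl lu U sH => [|l u'] pl lu U sH; first by rewrite -lu eqxx in tu.
  rewrite last_rcons in lu; subst u'.
  have E : perm_eq (t :: r ++ u :: rev l) (t :: rcons l u ++ r).
    by clear; apply/permP => P; rewrite /= !count_cat -cats1 count_cat /= count_rev;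
      do ?nat_norm; do ?nat_congr.
  exists (t :: r ++ u :: rev l); split.
  - rewrite /ucycle (perm_uniq E) U andbT /= rcons_cat cat_path pr rx /= xu.
    by rewrite -path_rev.
  - have : x \in t :: r by rewrite -rx mem_last.
    by rewrite -cat_cons mem_cat => ->.
  - rewrite (perm_mem E) inE mem_cat mem_rcons inE /t; case: (eqVneq u y) => //.
      by rewrite orbT.
    by rewrite eqxx.
  - by move=> w; rewrite (perm_mem E); apply: sH.
have vs : v \notin s by apply: contra vH => /sH.
have zs := wheel_free_cycle wf cyc_s vs vx vy vz Uxyz xs ys.
(* The branches of this fan are cut at their first vertices [p] and [q] on the cycle, which differ
   because the branches are disjoint. *)
have [l [r [[pl lx] [pr ry] U lrH]]] := biconnected_fan biH conH xH yH zH xy.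
have hit t a : path edge z t -> last z t = a -> a \in s ->
    exists t1 p t2, [/\ t = rcons t1 p ++ t2, p \in s & {in t1, forall u, u \notin s}].
  move=> pt ta sa; have ht : has (mem s) t.
    apply/hasP; exists a => //; move: (mem_last z t); rewrite ta inE => /predU1P[E|//].
    by rewrite -E sa in zs.
  case: {-1}_ _ _ / (split_find ht) (erefl t) => p t1 t2 ps /hasPn out Et.
  by exists t1, p, t2.
have [l1 [p [l2 [El ps out1]]]] := hit _ _ pl lx xs.
have [r1 [q [r2 [Er qs out2]]]] := hit _ _ pr ry ys.
have /andP[pl1 _] : path edge z (rcons l1 p) && path edge p l2.
  by move: pl; rewrite El cat_path last_rcons.
have /andP[pr1 _] : path edge z (rcons r1 q) && path edge q r2.
  by move: pr; rewrite Er cat_path last_rcons.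
have Ulr : uniq (z :: l1 ++ r1).
  apply: subseq_uniq U; rewrite El Er -!cats1 -!(catA _ [:: _]) /= eqxx.
  by apply: cat_subseq; exact: prefix_subseq.
have pq : p != q.
  move: U; rewrite cons_uniq cat_uniq => /and3P[_ _ /andP[/hasPn H' _]].
  apply: contraTneq (H' q _) => [<-|]; first by rewrite El mem_cat mem_rcons mem_head.
  by rewrite Er mem_cat mem_rcons mem_head.
(* The third path of the theta graph runs from [p] to [q] through [z], off the cycle. *)
set t := rev l1 ++ z :: r1.
have Et : perm_eq t (z :: l1 ++ r1).
  by apply/permP => P; rewrite /t /= !count_cat count_rev /=;
      do ?nat_norm; do ?nat_congr.
have tH : {subset t <= H}.
  move=> u; rewrite (perm_mem Et) => ut; apply: lrH; move: ut.
  by rewrite El Er !(inE, mem_cat, mem_rcons) => /or3P[] ->; rewrite ?orbT.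
have ts u : u \in t -> u \notin s.
  by rewrite (perm_mem Et) inE mem_cat => /or3P[/eqP->|/out1|/out2].
have pt : path edge p (rcons t q).
  by rewrite /t rcons_cat /= -cat_rcons cat_path last_rcons -path_rev pl1.
case/andP: cyc_s => cyc_s Us.
(* The other two paths are the arcs of the cycle, the second one reversed to run from [p] to [q]. *)
have [i s1 s2 _ _ Es] := rot_to_arc Us ps qs pq.
have es u : (u \in s) = (u \in [:: p, q & s1 ++ rev s2]).
  rewrite -(mem_rot i) Es !(inE, mem_cat, mem_rev).
  by case: (u == p); case: (u == q); rewrite /= ?orbT.
have [ps1 ps2] : path edge p (rcons s1 q) /\ path edge p (rcons (rev s2) q).
  have : cycle edge (rot i s) by rewrite rot_cycle.
  rewrite Es /= rcons_cat /= -cat_rcons cat_path last_rcons => /andP[-> ?].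
  by rewrite -path_rev.
have zt : z \in t by rewrite (perm_mem Et) mem_head.
move: zt; apply/negP.
apply: (theta_excluded wf nK ps1 ps2 pt _ vx vy vz Uxyz); rewrite -?es //.
have E : perm_eq [:: p, q, v & s1 ++ rev s2 ++ t] (v :: rot i s ++ t).
  by apply/permP => P; rewrite Es /= !count_cat /= count_rev;
      do ?nat_norm; do ?nat_congr.
rewrite (perm_uniq E) cons_uniq cat_uniq rot_uniq Us (perm_uniq Et) Ulr.
rewrite mem_cat mem_rot negb_or vs andbT (contra (@tH v)) //=.
by apply/hasPn => u; rewrite /= mem_rot; apply: ts.
Qed.

(** * Minimal sets with at most one vertex of low induced degree *)

(** The size bound rules out the singleton of [e], for which the degree condition is vacuous. *)
Definition degree_ge3_except S e :=
  [&& e \in S, 1 < #|S| & [forall v in S, (v != e) ==> (2 < #|neighbors v :&: S|)]].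

Lemma degree_ge3_exceptP S e :
  reflect [/\ e \in S, 1 < #|S| & {in S, forall v, v != e -> 2 < #|neighbors v :&: S|}]
          (degree_ge3_except S e).
Proof.
apply: (iffP and3P) => -[eS S1 degS]; split=> //.
  by move=> v vS; apply/implyP/(forall_inP degS).
by apply/forall_inP => v vS; apply/implyP; apply: degS.
Qed.

(** If a component of [S :\ x] misses [e], its vertices keep all their neighbours in [S] once [x] is
    added, so that the component with [x] is again such a set, now with exception [x]. By minimality
    it is [S], and the component is all of [S :\ x]. *)
Lemma degree_ge3_except_minimal_connected S e x :
  degree_ge3_except S e -> (forall T a, degree_ge3_except T a -> T \subset S -> T = S) ->
  x \in S -> connected (S :\ x).
Proof.
move=> /degree_ge3_exceptP[eS _ degS] minS xS.
pose D a := [set y | connect (induced_edge (S :\ x)) a y].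
have D_full a : a \in S :\ x -> e \notin D a -> S = x |: D a.
  move=> aS eD; have DS : D a \subset S :\ x.
    apply/subsetP=> y; rewrite inE; exact: connect_closed.
  have xD : x \notin D a by apply/negP=> /(subsetP DS); rewrite !inE eqxx.
  have aD : a \in D a by rewrite inE connect0.
  symmetry; apply: (minS _ x); last first.
    rewrite subUset sub1set xS; apply: subset_trans DS (subsetDl _ _).
  apply/degree_ge3_exceptP; split; first exact: setU11.
    by rewrite cardsU1 xD ltnS card_gt0; apply/set0Pn; exists a.
  move=> v; rewrite in_setU1 => /predU1P[->|vD _]; first by rewrite eqxx.
  have /setD1P[vx vS] := subsetP DS v vD.
  apply: leq_trans (degS v vS _) _; first by apply: contraNneq eD => <-.
  apply/subset_leq_card/subsetP => w; rewrite !inE => /andP[vw wS].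
  rewrite vw /=; case: eqVneq => //= wx; move: vD; rewrite inE => /connect_trans; apply.
  by apply: connect_induced1; rewrite // !inE ?vx ?wx.
apply/connectedP=> a b aS bS.
have [ea|ea] := boolP (e \in D a); last first.
  have /setD1P[bx bS'] := bS.
  have : b \in x |: D a by rewrite -(D_full a aS ea).
  by rewrite !inE (negPf bx).
have [eb|eb] := boolP (e \in D b); last first.
  have /setD1P[ax aS'] := aS.
  have : a \in x |: D b by rewrite -(D_full b bS eb).
  by rewrite !inE (negPf ax) connect_induced_sym.
move: ea eb; rewrite !inE [connect _ b e]connect_induced_sym; exact: connect_trans.
Qed.

Lemma degree_ge3_except_hub S e :
  degree_ge3_except S e -> {in S, forall x, connected (S :\ x)} ->
  exists v B, [/\ biconnected B, v \notin B & 2 < #|neighbors v :&: B|].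
Proof.
move=> /degree_ge3_exceptP[eS S1 degS] conS.
(* As [e] belongs to the second component, every vertex of [S] outside that component can replace
   the first one. *)
pose good (t : G * {set G}) :=
  [&& t.1 \in S, t.1 != e, t.2 \subset S :\ t.1, e \in t.2, 1 < #|t.2| & biconnected t.2].
have [v0 [v0S v0e]] : exists v, v \in S /\ v != e.
  by case/card_gt1P: S1 => x [y [xS yS xy]]; case: (eqVneq x e) => [xe|]; [exists y|exists x];
    rewrite // -xe eq_sym.
(* The initial biconnected set is an edge [eu] avoiding [v0]. It exists because [S :\ v0] is
   connected and contains a vertex other than [e]. *)
have [u [uS eu uv0]] : exists u, [/\ u \in S, edge e u & u != v0].
  have /card_gt2P[x [y [z [[]]]]] := degS v0 v0S v0e; rewrite !inE.
  move=> /andP[v0x xS] /andP[v0y yS] _ [xy _ _].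
  have [w [wS we wv0]] : exists w, [/\ w \in S, w != e & w != v0].
    have xv0 : x != v0 by apply: contraTneq v0x => ->; rewrite edge_irrefl.
    have yv0 : y != v0 by apply: contraTneq v0y => ->; rewrite edge_irrefl.
    by case: (eqVneq x e) => [xe|]; [exists y; rewrite yS -xe eq_sym xy|exists x].
  have /connectP[[|u s] /=] : connect (induced_edge (S :\ v0)) e w.
  - by apply: (connectedP _ (conS v0 v0S)); rewrite !inE ?wv0 ?wS // [e == _]eq_sym v0e eS.
  - by move=> _ E; rewrite E eqxx in we.
  - by case/andP=> /induced_edgeP[_ /setD1P[uv uS] eu] _ _; exists u.
have eu' : e != u by apply: contraTneq eu => ->; rewrite edge_irrefl.
have good0 : good (v0, [set e; u]).
  apply/and5P; split=> //=.
    by apply/subsetP=> w; rewrite !inE => /orP[]/eqP->; rewrite ?uS ?uv0 // eq_sym v0e eS.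
    by rewrite !inE eqxx.
  rewrite cards2 eu' /=; apply/forallP=> x; apply/connectedP=> a b.
  rewrite !inE => /andP[ax aeu] /andP[bx beu].
  case: (eqVneq a b) => [->|ab]; first exact: connect0.
  apply: connect_induced1; rewrite ?inE ?ax ?bx //.
  case/orP: aeu ab => /eqP->; case/orP: beu => /eqP->; rewrite ?eqxx // => _.
  by rewrite edge_sym.
case: (arg_maxnP (fun t : G * {set G} => #|t.2|) good0)
  => -[v B] /and5P[/= vS ve BS eB /andP[B1 biB]] maxB.
have vB : v \notin B by apply/negP => /(subsetP BS); rewrite !inE eqxx.
have sBS : B \subset S by apply: subset_trans BS (subsetDl _ _).
(* The size of [B] is maximal over all pairs, so an ear avoiding any [w] outside [B], not only [v],
   is contradictory. *)
have no_ear w D a b x y : w \in S -> w \notin B -> D \subset (S :\ w) :\: B ->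
    a \in B -> b \in B -> a != b -> x \in D -> connect (induced_edge D) x y ->
    edge a x -> edge b y -> False.
  move=> wS wB DS aB bB ab xD xy ax by_edge.
  have disj : [disjoint B & D].
    rewrite disjoint_sym; apply: disjointWl DS _.
    by rewrite -setI_eq0 setDE -setIA [_ :&: B]setIC setICr setI0.
  have [X [/[dup] /proper_card ltBX /proper_sub sBX XBD biX]] :=
    biconnected_ear biB disj aB bB ab xD xy ax by_edge.
  have XS : X \subset S :\ w.
    apply: subset_trans XBD _; rewrite subUset (subset_trans DS (subsetDl _ _)) andbT.
    by apply/subsetD1P.
  have := maxB (w, X); rewrite /good /= wS XS (subsetP sBX _ eB) biX.
  rewrite (ltn_trans B1 ltBX) andbT leqNgt ltBX /= => /(_ _).
  by case: eqVneq => [we|_ /(_ isT)//]; rewrite we eB in wB.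
have [SvB|/subsetPn[w0 w0S]] := boolP (S \subset v |: B).
  exists v, B; split=> //; apply: leq_trans (degS v vS ve) _.
  apply/subset_leq_card/subsetP => w; rewrite !inE => /andP[vw /(subsetP SvB)].
  by rewrite vw !inE => /predU1P[E|->//]; rewrite E edge_irrefl in vw.
rewrite in_setU1 negb_or => /andP[w0v w0B]; exfalso.
pose R := (S :\ v) :\: B.
pose K := [set y | connect (induced_edge R) w0 y].
have w0R : w0 \in R by rewrite !inE w0v w0B.
have KR : K \subset R by apply/subsetP=> y; rewrite inE; exact: connect_closed.
have K_S y : y \in K -> [/\ y \in S, y != v & y \notin B].
  by move/(subsetP KR); rewrite !inE => /and3P[-> ->].
have K_closed y z : y \in K -> z \in S -> z != v -> z \notin B -> edge y z -> z \in K.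
  move=> yK zS zv zB yz; have yR := subsetP KR y yK.
  move: yK; rewrite !inE => /connect_trans; apply.
  by apply: connect_induced1 => //; rewrite !inE zv zB.
have K_conn y z : y \in K -> z \in K -> connect (induced_edge R) y z.
  by rewrite !inE [connect _ w0 y]connect_induced_sym; exact: connect_trans.
(* Two attachments of [K] on [B] would give an ear avoiding [v]. *)
have [c cB K_c] : exists2 c, c \in B & forall y b, y \in K -> b \in B -> edge y b -> b = c.
  have [/existsP[c /andP[cB /exists_inP[y yK yc]]]|none] :=
    boolP [exists c, (c \in B) && [exists y in K, edge y c]].
    exists c => // z b zK bB zb; apply/eqP; apply/negPn/negP => bc.
    apply: (no_ear v R b c z y) => //; rewrite 1?edge_sym //.
      exact: (subsetP KR).
    exact: K_conn.
  (* Without attachments the condition on [c] is vacuous, and [e] is just some element of [B]. *)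
  exists e => // y b yK bB yb; case/negP: none; apply/existsP; exists b.
  by rewrite bB; apply/exists_inP; exists y.
have cS : c \in S by apply: (subsetP sBS).
have cv : c != v by apply: contraNneq vB => <-.
(* Otherwise [K] would be closed in [S :\ v], which is connected and contains [c]. *)
have [w1 w1K cw1] : exists2 w, w \in K & edge c w.
  have [|none] := boolP [exists w in K, edge c w].
    by case/exists_inP=> w; exists w.
  have: c \in K.
    apply: (@connect_closed (S :\ v) K w0).
    - move=> y z yK /setD1P[zv zS] yz; apply: (K_closed y z) => //.
      apply/negP=> zB; case/negP: none; apply/exists_inP; exists y => //.
      by rewrite edge_sym -(K_c y z).
    - by rewrite inE connect0.
    - by apply: (connectedP _ (conS v vS)); rewrite !inE ?w0v ?w0S ?cv ?cS.
  by case/K_S; rewrite cB.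
(* Otherwise [K] would be closed in [S :\ c], which is connected and contains [v]. *)
have [w' w'K w'v] : exists2 w, w \in K & edge w v.
  have [|none] := boolP [exists w in K, edge w v].
    by case/exists_inP=> w; exists w.
  have: v \in K.
    apply: (@connect_closed (S :\ c) K w0).
    - move=> y z yK /setD1P[zc zS] yz; apply: (K_closed y z) => //.
        by apply/negP=> /eqP zv; case/negP: none; apply/exists_inP; exists y; rewrite // -zv.
      by apply/negP=> zB; move: zc; rewrite (K_c y z) ?eqxx.
    - by rewrite inE connect0.
    - apply: (connectedP _ (conS c cS)); rewrite !inE ?w0S ?vS ?andbT 1?eq_sym //.
      by apply: contraNneq w0B => <-.
  by case/K_S; rewrite eqxx.
(* [v] still reaches [B] outside [c] when [K] is avoided, so a path from [c] to [v]
   through [K] avoiding [w] would be part of an ear avoiding [w]. *)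
have K_sep w k : w \in K -> edge c k -> k \in (S :\ w) :\: B ->
    ~ connect (induced_edge ((S :\ w) :\: B)) k v.
  move=> wK ck kR kv; have [wS wv wB] := K_S w wK.
  pose D := (S :\: K) :\: B; pose Dv := [set y | connect (induced_edge D) v y].
  have vD : v \in D.
    rewrite !in_setD vB vS andbT /=; apply/negP=> /K_S[_]; by rewrite eqxx.
  have DvD : Dv \subset D by apply/subsetP=> y; rewrite inE; exact: connect_closed.
  have [b [y [bB bc yDv yb]]] : exists b y, [/\ b \in B, b != c, y \in Dv & edge y b].
    have [|none] := boolP [exists b in B :\ c, [exists y in Dv, edge y b]].
      by case/exists_inP=> b /setD1P[bc bB] /exists_inP[y yDv yb]; exists b, y.
    have [b [bB bc]] : exists b, b \in B /\ b != c.
      by case/card_gt1P: B1 => x [y [xB yB xy]]; case: (eqVneq x c) => [xc|];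
        [exists y|exists x]; rewrite // -xc eq_sym.
    (* If no vertex of [Dv] has a neighbour in [B :\ c], then [Dv :|: K] is closed in the connected
       set [S :\ c]. *)
    have : b \in Dv :|: K.
      apply: (@connect_closed (S :\ c) _ v).
      - move=> y z yDK /setD1P[zc zS] yz.
        have zB : z \notin B.
          apply/negP=> zB; case/setUP: yDK => [yDv|yK].
            case/negP: none; apply/exists_inP; exists z; first by rewrite !inE zc.
            by apply/exists_inP; exists y.
          by move: zc; rewrite (K_c y z) ?eqxx.
        rewrite in_setU; have [zK|zK] := boolP (z \in K); first by rewrite orbT.
        rewrite orbF; case/setUP: yDK => [yDv|yK].
          have yD := subsetP DvD y yDv; move: yDv; rewrite !inE => /connect_trans; apply.
          by apply: connect_induced1 => //; rewrite !in_setD zB zS zK.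
        have [->|zv] := eqVneq z v; first by rewrite inE connect0.
        by rewrite (K_closed y z) in zK.
      - by rewrite in_setU inE connect0.
      - by apply: (connectedP _ (conS c cS)); rewrite !in_setD1 ?vS ?bc ?(subsetP sBS) // eq_sym cv.
    case/setUP=> [/(subsetP DvD)|/K_S[_ _]]; last by rewrite bB.
    by rewrite !inE bB.
  (* The ear runs from [c] through [k], [v] and [y] to [b]; its part from [v] to [y] avoids [w]
     because [Dv] is disjoint from [K]. *)
  apply: (no_ear w ((S :\ w) :\: B) c b k y wS wB) => //; rewrite 1?eq_sym 1?edge_sym //.
  apply: connect_trans kv _; move: yDv; rewrite inE; apply: connect_inducedS.
  apply: setSD; apply/subsetP=> z; rewrite in_setD in_setD1 => /andP[zK zS]; rewrite zS andbT.
  by apply: contraNneq zK => ->.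
have /connectP[s0 /shortenP[s sp Us _] Ew'] := K_conn w1 w' w1K w'K.
have {s0 sp} [ps sR] := path_induced sp.
have sK : {subset w1 :: s <= K}.
  move=> y ys; move: (w1K); rewrite !inE => /connect_trans; apply.
  by apply: (connect_on_path ps) ys => z; rewrite inE => /predU1P[->|/sR //];
    apply: (subsetP KR).
have psv : path edge w1 (rcons s v) by rewrite rcons_path ps -Ew'.
have in_del w y : y \in K \/ y = v -> y != w -> y \in (S :\ w) :\: B.
  by case=> [/K_S[yS _ yB]|->] yw; rewrite in_setD in_setD1 yw ?yB ?yS ?vB ?vS.
(* A vertex of [K] off the path from [w1] to [v] would not separate [c] from [v], contrary to
   [K_sep]. *)
have Ks : {subset K <= w1 :: s}.
  move=> w wK; apply/negPn/negP=> ws.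
  have w1w : w1 != w by apply: contraNneq ws => ->; rewrite mem_head.
  apply: (K_sep w w1 wK cw1); first by apply: in_del => //; left.
  apply: (connect_on_path psv); last by rewrite inE mem_rcons mem_head orbT.
  move=> y; rewrite -rcons_cons mem_rcons inE => /predU1P[->|ys]; apply: in_del.
  - by right.
  - by have [_ + _] := K_S w wK; rewrite eq_sym.
  - by left; apply: sK.
  - by apply: contraNneq ws => <-.
have [w1S w1v w1B] := K_S w1 w1K.
have w1e : w1 != e by apply: contraNneq w1B => ->.
(* Two neighbours in [S] are too few for [w1], which differs from [e] because [e] is in [B]. *)
suff [w2 sub] : exists w2, neighbors w1 :&: S \subset [set c; w2].
  have := leq_trans (degS w1 w1S w1e) (subset_leq_card sub).
  by rewrite cards2; case: eqP.
(* The successor of [w1] on the path to [v], which is [v] itself if [s] is empty. *)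
exists (head v s); apply/subsetP=> t; rewrite !inE => /andP[w1t tS].
have [tB|tB] := boolP (t \in B); first by rewrite (K_c w1 t) ?eqxx.
have tsv : t \in rcons s v.
  rewrite mem_rcons inE; have [//|tv] := eqVneq t v.
  have := Ks t (K_closed w1 t w1K tS tv tB w1t); rewrite inE => /predU1P[E|//].
  by rewrite E edge_irrefl in w1t.
case: s tsv psv sK Us {ps sR Ks Ew'} => [|w2 s] /=.
  by rewrite inE => /eqP->; rewrite eqxx orbT.
rewrite inE => /predU1P[->|ts]; first by rewrite eqxx orbT.
case/andP=> _ pw2 sK /and3P[]; rewrite inE negb_or => /andP[w12 _] w2s _.
have w2K : w2 \in K by apply: sK; rewrite !inE eqxx orbT.
have [_ w2v _] := K_S w2 w2K.
(* A neighbour [t] beyond [w2] would let [w1] reach [v] without [w2]. *)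
case: (K_sep w2 w1 w2K cw1); first by apply: in_del => //; left.
have s_del : {subset rcons s v <= (S :\ w2) :\: B}.
  move=> y; rewrite mem_rcons inE => /predU1P[->|ys]; apply: in_del.
  - by right.
  - by rewrite eq_sym.
  - by left; apply: sK; rewrite !inE ys !orbT.
  - by apply: contraNneq w2s => <-.
have w1t' : connect (induced_edge ((S :\ w2) :\: B)) w1 t.
  by apply: connect_induced1 => //; [apply: in_del => //; left | apply: s_del].
apply: connect_trans w1t' _.
have vs : v \in rcons s v by rewrite mem_rcons mem_head.
case Es: (rcons s v) ts vs s_del pw2 => [//|h s'] th vh h_del /= /andP[_ ph].
have := connect_on_path ph h_del vh; apply: connect_trans.
by rewrite connect_induced_sym; apply: (connect_on_path ph h_del).
Qed.

End WheelFree.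

(** * From vertices of low degree to a minimal set *)

Theorem theorem4p9 (G : sgraph) :
  2 <= #|G| ->
  wheel_free G ->
  ~ contains_subdivision (complete_bipartite 3 3) G ->
  2 <= #|[set v : G | degree v <= 2]|.
Proof.
move=> G2 wf nK; rewrite leqNgt; apply/negP => low.
(* If no vertex has degree at most 2, any vertex serves as the exception. *)
have [e e_low] : exists e : G, {subset [set v : G | degree v <= 2] <= [set e]}.
  have /card_gt1P[e0 _] := G2.
  have [->|[e eL]] := set_0Vmem [set v : G | degree v <= 2].
    by exists e0 => v; rewrite in_set0.
  by exists e => v vL; rewrite inE; apply/eqP/(card_le1_eqP low).
(* The exception is quantified inside [P], so that a set minimal for [P] is minimal over all
   exceptions, as [degree_ge3_except_minimal_connected] requires. *)
pose P (S : {set G}) := [exists a, degree_ge3_except S a].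
have PT : P setT.
  apply/existsP; exists e; apply/degree_ge3_exceptP; split; rewrite ?inE ?cardsT //.
  move=> v _ ve; rewrite setIT ltnNge; apply: contra ve => v_low.
  by have := e_low v; rewrite !inE; apply.
have [S /minsetP[/existsP[a nS] minS] _] := minset_exists PT.
have conS : {in S, forall x, connected (S :\ x)}.
  move=> x; apply: (degree_ge3_except_minimal_connected nS) => T b nT; apply: minS.
  by apply/existsP; exists b.
have [v [B [biB vB /card_gt2P[x [y [z [[]]]]]]]] := degree_ge3_except_hub nS conS.
rewrite !inE => /andP[vx xB] /andP[vy yB] /andP[vz zB] [xy yz zx].
have Uxyz : uniq [:: x; y; z] by rewrite /= !inE negb_or xy yz eq_sym zx.
by have := biconnected_excluded wf nK biB vB vx vy vz Uxyz xB yB; rewrite zB.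
Qed.
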